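(* Let $p \geq 3$ be a prime number and let $X = (X,s)$ be a quandle with $\# X = p$. Then the following conditions are mutually equivalent: (1) $X$ is two-point homogeneous; (2) $X$ is isomorphic to the linear Alexander quandle $\Lambda_p/(t-a)$ for some primitive root $a$ modulo $p$; (3) $X$ is of cyclic type.
   Context: A quandle $(X,s)$ is a set $X$ with a map $s_x : X \to X$ for each $x \in X$ such that: (S1) $s_x(x) = x$ for all $x\in X$; (S2) $s_x$ is bijective for all $x\in X$; (S3) $s_x \circ s_y = s_{s_x(y)} \circ s_x$ for all $x,y \in X$. A homomorphism $f : (X,s^X) \to (Y,s^Y)$ is a map with $f\circ s^X_x = s^Y_{f(x)} \circ f$ for all $x \in X$; an isomorphism is a bijective homomorphism. The inner automorphism group $G = \mathrm{Inn}(X,s)$ is the group of bijections of $X$ generated by $\{ s_x \mid x \in X\}$. A quandle $X$ is two-point homogeneous if for all $(x_1,x_2),(y_1,y_2)\in X\times X$ with $x_1\neq x_2$ and $y_1\neq y_2$ there exists $f \in \mathrm{Inn}(X,s)$ with $f(x_1)=y_1$ and $f(x_2)=y_2$. A quandle $(X,s)$ with finite cardinality $\# X = n \geq 3$ is of cyclic type if for every $x\in X$ the restriction of $s_x$ to $X\setminus\{x\}$ is a cyclic permutation of order $n-1$ (a single cycle through all $n-1$ elements of $X\setminus\{x\}$). The linear Alexander quandle $\Lambda_p/(t-a)$, where $\Lambda_p = \mathbb{Z}_p[t^{\pm1}]$ is the Laurent polynomial ring over $\mathbb{Z}_p = \mathbb{Z}/p\mathbb{Z}$, is identified with the set $\mathbb{Z}_p$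 equipped with the quandle structure $s_{[x]}([y]) = [a][y] + [1-a][x]$. A primitive root modulo $p$ is an integer $a$ with $2\leq a \leq p-1$ such that $[a]$ generates the multiplicative group $(\mathbb{Z}_p)^\times = \mathbb{Z}_p\setminus\{[0]\}$. *)

(* Defs.v *)
From HB Require Import structures.
From mathcomp Require Import all_boot all_order all_fingroup all_algebra all_solvable.
From mathcomp Require Import ring.

Set Implicit Arguments.
Unset Strict Implicit.
Unset Printing Implicit Defensive.

Import GRing.Theory.
Local Open Scope ring_scope.

Record quandle (X : Type) := Quandle {
  qop :> X -> X -> X;
  qop_idem : forall x, qop x x = x;
  qop_bij : forall x, bijective (qop x);
  qop_dist : forall x y, qop x \o qop y =1 qop (qop x y) \o qop x
}.

Definition quandle_hom (X Y : Type) (s : quandle X) (t : quandle Y)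
    (f : X -> Y) : Prop :=
  forall x, f \o s x =1 t (f x) \o f.

Definition quandle_isomorphic (X Y : Type) (s : quandle X) (t : quandle Y) :
    Prop :=
  exists2 f : X -> Y, quandle_hom s t f & bijective f.

Definition qperm (X : finType) (s : quandle X) (x : X) : {perm X} :=
  perm (bij_inj (qop_bij s x)).

Definition Inn (X : finType) (s : quandle X) : {group {perm X}} :=
  <<[set qperm s x | x : X]>>%G.

Definition two_point_homogeneous (X : finType) (s : quandle X) : Prop :=
  forall x1 x2 y1 y2 : X, x1 != x2 -> y1 != y2 ->
    exists2 f : {perm X}, f \in Inn s & f x1 = y1 /\ f x2 = y2.

(* [restr_perm [set~ x] (qperm s x)] is the restriction of s_x to X \ {x},
   extended by the identity at x; the condition says that X \ {x} is one of
   its cycles, so that it is a single cycle of length #|X| - 1. *)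
Definition cyclic_type (X : finType) (s : quandle X) : Prop :=
  (3 <= #|X|)%N /\
  forall x : X, [set~ x] \in porbits (restr_perm [set~ x] (qperm s x)).

Section LinearAlexander.

Variables (p a : nat) (a_unit : (a%:R : 'F_p) \is a GRing.unit).

Definition alexander_op (x y : 'F_p) : 'F_p := a%:R * y + (1 - a%:R) * x.

Fact alexander_idem x : alexander_op x x = x.
Proof. by rewrite /alexander_op; ring. Qed.

Fact alexander_bij x : bijective (alexander_op x).
Proof.
exists (fun z => a%:R^-1 * (z - (1 - a%:R) * x)) => z; rewrite /alexander_op.
- by rewrite addrK mulKr.
- by rewrite mulVKr // subrK.
Qed.

Fact alexander_dist x y :
  alexander_op x \o alexander_op y
    =1 alexander_op (alexander_op x y) \o alexander_op x.
Proof. by move=> z; rewrite /= /alexander_op; ring. Qed.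

(* Lambda_p/(t - a), carried by Z/pZ ('F_p is Z/pZ for p prime). *)
Definition linear_alexander : quandle 'F_p :=
  Quandle alexander_idem alexander_bij alexander_dist.

End LinearAlexander.

Definition primitive_root (p a : nat) : Prop :=
  (2 <= a <= p - 1)%N /\
  exists2 u : {unit 'F_p}, val u = a%:R & generator [set: {unit 'F_p}] u.

(* Main.v *)
Require Import Defs.
From mathcomp Require Import all_boot all_order all_fingroup all_algebra all_solvable.
From mathcomp Require Import all_field all_character.
From mathcomp Require Import ring.

(* The hard implication is (1) => (2). Let G = Inn(X), which is transitive of
   prime degree p, and let c in G be a p-cycle, so that C_G(c) = <c> and p
   exactly divides |G|. The class of s_x generates G and its size divides p. If
   chi is a nonlinear irreducible character of G, then either p divides chi(1),
   and chi(c) = 0 (chi has p-defect zero), or p does not, and chi(s_x) = 0 by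
   Burnside's lemma on class sizes coprime to the degree. Hence the number of
   solutions of c = s_x^-1 s_y is nonzero. Writing y = c^k x, the identities
   s_y = s_x c = c^-k s_x c^k show that s_x normalises <c>, that is, s_x is an
   affine map in the coordinate i |-> c^i x; it is then multiplication by some
   a, and two-point homogeneity says that the powers of a exhaust the units.
   (2) => (3) is a computation, and (3) => (1) holds because s_x is transitive
   on the complement of x. *)

Set Implicit Arguments.
Unset Strict Implicit.
Unset Printing Implicit Defensive.

Import Order.TTheory GRing.Theory Num.Theory.

(** * Character values at an element of order [p], and quotients of conjugates *)

Section Characters.
Local Open Scope group_scope.
Local Open Scope ring_scope.

Section DefectZero.
Variables (gT : finGroupType) (G : {group gT}) (p : nat) (c : gT).
Hypotheses (p_pr : prime p) (Gc : c \in G) (oc : #[c]%g = p)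
  (cent_c : 'C_G[c]%g = <[c]>%g) (coGc : coprime p #|c ^: G|).

Lemma prime_cycle_gen x : x \in (<[c]>^#)%g -> <[x]>%g = <[c]>%g.
Proof.
rewrite !inE => /andP[ntx cx]; apply/esym.
by apply: nt_gen_prime => //; [rewrite -orderE oc | rewrite !inE ntx].
Qed.

Lemma cent1_prime_cycle x : x \in (<[c]>^#)%g -> 'C_G[x]%g = <[c]>%g.
Proof. by move/prime_cycle_gen=> e; rewrite -cent_cycle e cent_cycle. Qed.

(* The numbers 'chi_i x / p, for x != 1 in <[c]>, are algebraic integers, so
   the sum S / p ^ 2 of their squared moduli is a natural number; column
   orthogonality makes it smaller than 1. *)
Lemma irr_defect0 i : (p %| Num.truncn ('chi[G]_i 1%g))%N -> 'chi_i c = 0.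
Proof.
set n := Num.truncn _ => /dvdnP[m Dn].
have Dchi1 : 'chi_i 1%g = (m * p)%:R by rewrite -Dn truncnK ?Cnat_irr1.
have p_gt0 := prime_gt0 p_pr.
have nz_p : p%:R != 0 :> algC by rewrite pnatr_eq0 -lt0n.
have nz_m : m%:R != 0 :> algC.
  by apply: contraTneq (irr1_neq0 i) => m0; rewrite Dchi1 natrM m0 mul0r eqxx.
have sPG : <[c]>%g \subset G by rewrite cycle_subG.
pose alpha x := 'chi_i x / p%:R.
have Aalpha x : x \in (<[c]>^#)%g -> alpha x \in Aint.
  move=> Px; have Gx : x \in G by apply: (subsetP sPG); case/setD1P: Px.
  have coGx : coprime p #|(x ^: G)%g|.
    by rewrite -index_cent1 cent1_prime_cycle // -cent_c index_cent1.
  have A1 : #|(x ^: G)%g|%:R * alpha x \in Aint.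
    have -> : #|(x ^: G)%g|%:R * alpha x =
        m%:R * (#|(x ^: G)%g|%:R * 'chi_i x / 'chi_i 1%g).
      by rewrite Dchi1 natrM invfM /alpha mulrA [RHS]mulrCA mulVKf // mulrA.
    by rewrite rpredM ?rpred_nat ?Aint_class_div_irr1.
  (* With K the class of [x], Bezout gives 1 + u |K| = v p, so [alpha x] is an integral combination
     of ['chi_i x] and |K| [alpha x]. *)
  have [u _ /dvdnP[v eq_uv]] := Bezoutl #|(x ^: G)%g| p_gt0.
  suffices ->: alpha x = v%:R * 'chi_i x - u%:R * (#|(x ^: G)%g|%:R * alpha x).
    by rewrite rpredB // rpredM ?rpred_nat ?Aint_irr.
  have -> : 'chi_i x = p%:R * alpha x by rewrite mulrC divfK.
  rewrite !mulrA -!natrM -eq_uv (eqnP coGx) -mulrBl natrD.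
  by rewrite -mulrBl addrK mulr1n mul1r.
pose S := \sum_(x in (<[c]>^#)%g) `|'chi_i x| ^+ 2.
have AS : S / (p%:R ^+ 2) \in Aint.
  rewrite mulr_suml rpred_sum // => x Px.
  have -> : `|'chi_i x| ^+ 2 / p%:R ^+ 2 = alpha x * alpha x^-1%g.
    by rewrite normCK /alpha char_inv ?irr_char // expr2 invfM mulrACA.
  by rewrite rpredM ?Aalpha // !inE invg_eq1 groupV; move: Px; rewrite !inE.
(* The squared norm of the restriction to [<[c]>] is an integer, so this makes S / p ^ 2 rational;
   being an algebraic integer, it is then an integer. *)
have DS : S = p%:R * '['Res[<[c]>%g] 'chi_i] - 'chi_i 1%g ^+ 2.
  rewrite (cfnormE (cfun_onG _)) -[#|_|]/(#[c]%g) oc mulVKf //.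
  rewrite (big_setD1 1%g) //=.
  rewrite cfResE // ger0_norm ?char1_ge0 ?irr_char // addrAC subrr add0r.
  by apply: eq_bigr => x /setD1P[_ Px]; rewrite cfResE.
have ZS : S / (p%:R ^+ 2) \in Num.int.
  apply: Cint_rat_Aint AS; rewrite rpred_div ?rpredX ?rpred_nat //.
  have /natrP[k Dk] : '['Res[<[c]>%g] 'chi_i] \is a Num.nat.
    by rewrite Cnat_cfdot_char ?cfRes_char ?irr_char.
  by rewrite DS Dk Dchi1 -natrX -natrM rpredB ?rpred_nat.
have S_ge0 : 0 <= S by apply: sumr_ge0 => x _; rewrite exprn_ge0.
have ltS : S < p%:R ^+ 2.
  (* Each of the p - 1 terms is at most |C_G(x)| = p. *)
  apply: (@le_lt_trans _ _ (p.-1 * p)%:R); last first.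
    by rewrite -natrX ltr_nat expnS expn1 ltn_mul2r p_gt0 prednK /=.
  have -> : p.-1 = #|(<[c]>^#)%g| by rewrite -oc /order (cardsD1 1%g) group1.
  rewrite mulnC natrM mulr_natr -sumr_const ler_sum // => x Px.
  have Gx : x \in G by apply: (subsetP sPG); case/setD1P: Px.
  have := second_orthogonality_relation x Gx.
  rewrite class_refl cent1_prime_cycle // -[#|_|]/(#[c]%g) oc mulr1n => <-.
  rewrite (bigD1 i) //= -normCK lerDl sumr_ge0 // => j _.
  by rewrite -normCK exprn_ge0.
have S0 : S / p%:R ^+ 2 = 0.
  apply/eqP; apply: contraTT ZS => nzS; apply/negP => /norm_intr_ge1/(_ nzS).
  have p2_gt0 : 0 < p%:R ^+ 2 :> algC by rewrite exprn_gt0 ?ltr0n.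
  rewrite ger0_norm; last by rewrite divr_ge0 // ltW.
  by rewrite ler_pdivlMr // mul1r lt_geF.
move/eqP: S0; rewrite mulf_eq0 invr_eq0 expf_eq0 /= (negPf nz_p) orbF.
rewrite psumr_eq0 => [/allP/(_ c)|x _]; last exact: exprn_ge0.
have ntc : c != 1%g by rewrite -order_gt1 oc prime_gt1.
rewrite mem_index_enum !inE ntc cycle_id expf_eq0 /= normr_eq0.
by move/(_ isT)/eqP.
Qed.

End DefectZero.

(** By Burnside's lemma, ['chi_i g] vanishes unless [g] lies in the centre of ['chi_i]. That centre
    is normal, so it is then all of [G], and the bound of chi(1) ^ 2 by its index gives degree 1. *)
Lemma irr_lin_or_class_vanish (gT : finGroupType) (G : {group gT}) (g : gT) i :
  g \in G -> <<g ^: G>>%g = G ->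
  coprime (Num.truncn ('chi[G]_i 1%g)) #|(g ^: G)%g| ->
  'chi_i \is a linear_char \/ 'chi_i g = 0.
Proof.
move=> Gg genG co; have [Zg|nZg] := boolP (g \in 'Z('chi_i)%CF); last first.
  by right; apply: coprime_degree_support_cfcenter.
left; have ZG : 'Z('chi_i)%CF = G.
  apply/eqP; rewrite eqEsubset cfcenter_sub -{1}genG gen_subG /=.
  by rewrite class_sub_norm ?normal_norm ?cfcenter_normal.
have [] := irr1_bound i; rewrite ZG indexgg => le1 _; move: le1.
rewrite irr1_degree -natrX ler_nat => le1.
apply/andP; split; first exact: irr_char.
rewrite irr1_degree pnatr_eq1 eqn_leq irr_degree_gt0 andbT.
by move: le1; case: (irr_degree _) => [|[]].
Qed.

Section ClassQuotient.
Variables (gT : finGroupType) (G : {group gT}) (p : nat) (g c : gT).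
Hypotheses (p_pr : prime p) (Gg : g \in G) (genG : <<g ^: G>>%g = G)
  (card_gG : (#|g ^: G|%g %| p)%N) (og : coprime p #[g]%g)
  (Gc : c \in G) (oc : #[c]%g = p)
  (cent_c : 'C_G[c]%g = <[c]>%g) (coGc : coprime p #|c ^: G|).

(** With n the order of [g], [xi ^+ n] is trivial at [g], hence on [G]. So [c ^+ n], a generator of
    [<[c]>], lies in the kernel of [xi]. *)
Lemma lin_char_coprime_order (xi : 'CF(G)) : xi \is a linear_char -> xi c = 1.
Proof.
move=> lin_xi; set n := #[g]%g.
have lin_xin : xi ^+ n \is a linear_char by rewrite rpredX.
have xin1 x : x \in cfker (xi ^+ n) = (x \in G) && (xi (x ^+ n)%g == 1).
  rewrite cfkerEchar ?lin_charW // inE lin_char1 //.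
  by case: (boolP (x \in G)) => //= Gx; rewrite lin_charX // exp_cfunE.
have : c \in cfker (xi ^+ n).
  suffices /subsetP/(_ c Gc) : G \subset cfker (xi ^+ n) by apply.
  rewrite -{1}genG gen_subG class_sub_norm ?normal_norm ?cfker_normal //.
  by rewrite xin1 Gg expg_order lin_char1 ?eqxx.
rewrite xin1 Gc /= => /eqP xicn.
have genc : generator <[c]>%g (c ^+ n)%g by rewrite generator_coprime oc.
have : c \in cfker xi.
  rewrite -cycle_subG (eqP genc) cycle_subG /= cfkerEchar ?lin_charW // inE.
  by rewrite groupX //= xicn lin_char1.
by move/cfker1->; rewrite lin_char1.
Qed.

(* By [irr_defect0] and [irr_lin_or_class_vanish] only linear characters, each
   with value 1, contribute to the class multiplication coefficient counting
   the solutions of [c = x^-1 * y]. *)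
Lemma mem_class_quotient :
  exists x y, [/\ x \in (g ^: G)%g, y \in (g ^: G)%g & c = (x^-1 * y)%g].
Proof.
have cG := mem_classes.
pose k1 := enum_rank_in (cG _ _ _ (groupVr Gg)) (g^-1 ^: G)%g.
pose k2 := enum_rank_in (cG _ _ _ Gg) (g ^: G)%g.
pose k := enum_rank_in (cG _ _ _ Gc) (c ^: G)%g.
have K1 : g^-1%g \in enum_val k1.
  by rewrite enum_rankK_in ?cG ?groupV ?class_refl.
have K2 : g \in enum_val k2 by rewrite enum_rankK_in ?cG ?class_refl.
have K : c \in enum_val k by rewrite enum_rankK_in ?cG ?class_refl.
have := gring_classM_coef_sum_eq K1 K2 K => /=.
rewrite (set_gring_classM_coef k1 k2 K).
set S := gring_classM_coef_set _ _ _; have [S0|[[x y]]] := set_0Vmem S.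
  rewrite S0 cards0 => /esym/eqP; rewrite !mulf_eq0 invr_eq0 !pnatr_eq0.
  have nz1 : #|enum_val k1| != 0%N.
    by rewrite -lt0n card_gt0; apply/set0Pn; exists g^-1%g.
  have nz2 : #|enum_val k2| != 0%N.
    by rewrite -lt0n card_gt0; apply/set0Pn; exists g.
  rewrite muln_eq0 (negPf nz1) (negPf nz2) -(negbK (_ == 0)) -lt0n cardG_gt0 /=.
  (* The sum thus counts the linear characters, and the principal one keeps it from vanishing. *)
  suffices Di i : 'chi_i g^-1%g * 'chi_i g * ('chi_i c)^* / 'chi_i 1%g
      = ('chi[G]_i \is a linear_char)%:R.
    rewrite (eq_bigr _ (fun i _ => Di i)) (bigD1 0) //= irr0 cfun1_lin_char.
    by rewrite -natr_sum -natrD pnatr_eq0.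
  have [lin_i|nlin_i] := boolP (_ \is a _).
    rewrite lin_charV // mulVf ?lin_char_neq0 // lin_char1 //.
    by rewrite lin_char_coprime_order // rmorph1 divr1 mulr1.
  have [pd|pnd] := boolP (p %| Num.truncn ('chi[G]_i 1%g))%N.
    by rewrite (@irr_defect0 _ _ p c) // rmorph0 mulr0 mul0r.
  have [|lin_i|->] := @irr_lin_or_class_vanish _ G g i Gg genG.
  - by apply: coprime_dvdr card_gG _; rewrite coprime_sym prime_coprime.
  - by rewrite lin_i in nlin_i.
  by rewrite mulr0 !mul0r.
rewrite !inE /= !enum_rankK_in ?cG ?groupV // => /andP[/andP[g1x gy] /eqP <-] _.
exists x^-1%g, y; split=> //; last by rewrite invgK.
by move: g1x => /imsetP[z Gz ->]; rewrite -conjVg invgK memJ_class.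
Qed.

End ClassQuotient.

End Characters.

(** * Permutations of a set of prime cardinality *)

Section PrimeDegree.
Local Open Scope group_scope.
Variables (X : finType) (p : nat).
Hypotheses (p_pr : prime p) (cardX : #|X| = p).

(** Orbit sizes of [<[c]>] divide [p], so the orbit of a moved point has [p] elements and is
    everything. *)
Lemma prime_perm_transitive (c : {perm X}) :
  #[c] = p -> forall x y, exists k, y = (c ^+ k) x.
Proof.
move=> oc; have ntc : c != 1 by rewrite -order_gt1 oc prime_gt1.
have /existsP[x0 cx0] : [exists x, c x != x].
  apply: contraNT ntc => /existsPn fix_c; apply/eqP/permP => x.
  by rewrite perm1; apply/eqP; have := fix_c x; rewrite negbK.
have full : porbit c x0 = setT.
  apply/eqP; rewrite eqEcard subsetT cardsT cardX /=.
  have := dvdn_orbit 'P <[c]> x0; rewrite -porbitE -[#|<[c]>|]/(#[c]) oc.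
  case/primeP: p_pr => _ dvdp /dvdp /orP[/eqP|/eqP-> //].
  rewrite porbitE => /card_orbit1 orb1; have := mem_porbit c 1 x0.
  by rewrite porbitE orb1 inE expg1 (negPf cx0).
have orb y : porbit c y = setT.
  by rewrite -full; apply/eqP; rewrite eq_porbit_mem full inE.
by move=> x y; apply/porbitP; rewrite orb inE.
Qed.

(** Otherwise a power of [s] has order [p], hence is transitive, yet fixes [x]. *)
Lemma fixing_perm_coprime (s : {perm X}) x : s x = x -> coprime p #[s].
Proof.
move=> sx; rewrite prime_coprime //; apply/negP => pds.
have oc : #[s ^+ (#[s] %/ p)] = p.
  by rewrite orderXdiv ?dvdn_div // ?divnA // ?mulKn // ?order_gt0.
suffices : #|X| <= 1 by rewrite cardX leqNgt prime_gt1.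
rewrite -cardsT -(cards1 x); apply: subset_leq_card; apply/subsetP => y _.
have [k ->] := prime_perm_transitive oc x y.
by rewrite inE -expgM permX_fix.
Qed.

(** A permutation commuting with the transitive [c] is determined by its value at one point, where
    it agrees with some power of [c]. *)
Lemma cent_prime_perm (c : {perm X}) (G : {group {perm X}}) :
  #[c] = p -> c \in G -> 'C_G[c] = <[c]>.
Proof.
move=> oc Gc; apply/eqP; rewrite eqEsubset; apply/andP; split; last first.
  by rewrite subsetI !cycle_subG Gc cent1id.
apply/subsetP => h /setIP[_ /cent1P ch].
have [x _] : exists x : X, x \in X by apply/card_gt0P; rewrite cardX prime_gt0.
have [k hx] := prime_perm_transitive oc x (h x).
have -> : h = c ^+ k; last exact: mem_cycle.
apply/permP => y; have [j ->] := prime_perm_transitive oc x y.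
have cj : commute h (c ^+ j) by apply: commuteX.
by rewrite -permM -cj permM hx -!permM -!expgD addnC.
Qed.

Lemma coprime_fact n : n < p -> coprime p n`!.
Proof.
elim: n => [|n IHn] ltnp; first exact: coprimen1.
by rewrite factS coprimeMr IHn 1?ltnW // prime_coprime // gtnNdvd.
Qed.

(** The centraliser has order [p] and |G| divides p!, so the class size divides (p - 1)!. *)
Lemma prime_perm_class_coprime (c : {perm X}) (G : {group {perm X}}) :
  #[c] = p -> c \in G -> coprime p #|c ^: G|.
Proof.
move=> oc Gc; have := cardSg (subsetT G).
rewrite -(Lagrange (subsetIl G 'C[c])) index_cent1 /= cent_prime_perm //.
rewrite -[#|<[c]>|]/(#[c]) oc.
have -> : #|[set: {perm X}]| = p `!.
  rewrite -cardX -(cardsT X) -card_perm; apply: eq_card => s.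
  by rewrite in_setT; apply/esym/subsetP => x _; rewrite in_setT.
have p_gt0 := prime_gt0 p_pr.
rewrite -(prednK p_gt0) factS prednK // dvdn_pmul2l // => /coprime_dvdr; apply.
by apply: coprime_fact; rewrite prednK.
Qed.

End PrimeDegree.

(** * The inner automorphism group and its action on the maps s_x *)

Section InnerGroup.
Local Open Scope group_scope.
Variables (X : finType) (s : quandle X).

Lemma qpermE x y : qperm s x y = s x y.
Proof. exact: permE. Qed.

Lemma mem_Inn x : qperm s x \in Inn s.
Proof. by apply: mem_gen; apply: imset_f. Qed.

(** In a finite group, generators already generate as a monoid. *)
Lemma Inn_ind (P : {perm X} -> Prop) :
  P 1 -> (forall t x, P t -> P (t * qperm s x)) -> forall t, t \in Inn s -> P t.
Proof.
move=> P1 PM t /gen_prodgP[n [c s_c ->{t}]].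
elim: n c s_c => [|n IHn] c s_c; first by rewrite big_ord0.
rewrite big_ord_recr /=; have /imsetP[x _ ->] := s_c ord_max.
exact/PM/IHn.
Qed.

(** For a generator this is axiom (S3). *)
Lemma qperm_conj t x : t \in Inn s -> qperm s x ^ t = qperm s (t x).
Proof.
move: t; apply: Inn_ind => [|t z IHt]; first by rewrite conjg1 perm1.
rewrite conjgM IHt permM qpermE; apply/permP => y.
rewrite -[y](permKV (qperm s z)) permJ !qpermE.
exact: qop_dist.
Qed.

Definition Inn_transitive := forall x y, exists2 t, t \in Inn s & t x = y.

Hypothesis trans_s : Inn_transitive.

Lemma qperm_class x : qperm s x ^: Inn s = [set qperm s y | y : X].
Proof.
apply/setP => t; apply/imsetP/imsetP => [[u Gu ->]|[y _ ->]].
  by exists (u x); rewrite ?qperm_conj.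
by have [u Gu <-] := trans_s x y; exists u; rewrite ?qperm_conj.
Qed.

Lemma card_Inn_stab x : #|Inn s : 'C_(Inn s)[x | 'P]| = #|X|.
Proof.
rewrite -card_orbit; apply: eq_card => y; apply/orbitP.
by have [u Gu <-] := trans_s x y; exists u.
Qed.

(** By [qperm_conj] the stabiliser of [x] centralises s_x, so the index of the centraliser divides
    that of the stabiliser. *)
Lemma card_qperm_class x : #|qperm s x ^: Inn s| %| #|X|.
Proof.
rewrite -(card_Inn_stab x) -index_cent1 indexgS // subsetI subsetIl /=.
apply/subsetP => t /setIP[Gt /astab1P tx]; rewrite /= apermE in tx.
apply/cent1P.
by rewrite /commute [RHS]conjgC qperm_conj // tx.
Qed.

Variable p : nat.
Hypotheses (p_pr : prime p) (cardX : #|X| = p).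

(** Point stabilisers have index [p], so Cauchy's theorem supplies an element of order [p], to which
    [mem_class_quotient] applies. *)
Lemma qperm_quotient_order : exists x y, #[(qperm s x)^-1 * qperm s y] = p.
Proof.
have [o _] : exists x : X, x \in X by apply/card_gt0P; rewrite cardX prime_gt0.
have [c Gc oc] : {c | c \in Inn s & #[c] = p}.
  by apply: Cauchy => //; rewrite -cardX -(card_Inn_stab o) dvdn_indexg.
have := mem_class_quotient p_pr (mem_Inn o) _ _ _ Gc oc.
case => //.
- by rewrite qperm_class.
- by rewrite -cardX card_qperm_class.
- by apply: (fixing_perm_coprime p_pr cardX (x := o)); rewrite qpermE qop_idem.
- exact: (cent_prime_perm p_pr cardX).
- exact: (prime_perm_class_coprime p_pr cardX).
move=> u [v []]; rewrite qperm_class.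
move=> /imsetP[x _ ->{u}] /imsetP[y _ ->{v}] Dc.
by exists x, y; rewrite -Dc.
Qed.

(* If [s_y = s_x * c] and [y = c ^+ k x], then also [s_y = s_x ^ (c ^+ k)], and
   comparing both forces [s_x] to normalise [<[c]>]. *)
Lemma qperm_normalizes_cycle :
  exists o c a, [/\ c \in Inn s, #[c] = p, a < p & c ^ qperm s o = c ^+ a].
Proof.
have [x [y]] := qperm_quotient_order; set c := _^-1 * _ => oc.
have Gc : c \in Inn s by rewrite groupM ?groupV ?mem_Inn.
have [k Dy] := prime_perm_transitive p_pr cardX oc x y.
exists x, c.
suffices : c ^ qperm s x \in <[c]> by case/cyclePmin => a; rewrite oc; exists a.
(* If [p] divided [k], then y = x and c = 1. *)
have cok : coprime #[c] k.
  rewrite oc prime_coprime //; apply/negP => /dvdnP[m Dk].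
  have yx : y = x by rewrite Dy Dk mulnC expgM -oc expg_order expg1n perm1.
  by have := prime_gt1 p_pr; rewrite -oc order_gt1 /c yx mulVg eqxx.
have ckx : (c ^+ k) ^ qperm s x = c ^+ k * c^-1.
  have : qperm s x ^ (c ^+ k) = qperm s x * c.
    by rewrite qperm_conj ?groupX // -Dy /c mulKVg.
  move=> sx_ck; apply: (mulgI (qperm s x)); apply: (mulIg c).
  by rewrite conjgE mulKVg -!mulgA mulVg mulg1 -sx_ck -conjgC.
(* Since [c ^+ k] generates [<[c]>], it suffices that its conjugate by s_x lies in [<[c]>]. *)
have : <[c]> \subset <[c]> :^ (qperm s x)^-1.
  rewrite -generator_coprime in cok; rewrite {1}(eqP cok).
  by rewrite cycle_subG mem_conjgV ckx groupM ?groupV ?mem_cycle ?cycle_id.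
by rewrite cycle_subG mem_conjgV.
Qed.

End InnerGroup.

Local Open Scope ring_scope.

(** * Transitive quandles of prime order are linear Alexander quandles *)

Section TransitiveQuandle.
Variables (X : finType) (s : quandle X).
Variable p : nat.
Hypotheses (p_pr : prime p) (cardX : #|X| = p).

(** In the coordinate i |-> c^i o, s_o is multiplication by [a], and the map at c^i o is its
    conjugate by the translation c^i. *)
Lemma transitive_affine : Inn_transitive s ->
  exists (a : nat) (a_unit : (a%:R : 'F_p) \is a GRing.unit),
    (a < p)%N /\ quandle_isomorphic s (linear_alexander a_unit).
Proof.
move=> trans_s.
have [o [c [a [Gc oc a_ltp Dca]]]] := qperm_normalizes_cycle trans_s p_pr cardX.
have a_unit : (a%:R : 'F_p) \is a GRing.unit.
  rewrite unitFpE // prime_coprime //; apply: contraTN (prime_gt1 p_pr) => pa.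
  have c1 : (c ^ qperm s o)%g == 1%g by rewrite Dca -order_dvdn oc.
  by rewrite -oc order_gt1 negbK -(conjg_eq1 _ (qperm s o)).
exists a, a_unit; split=> //.
pose e (i : 'F_p) := (c ^+ i)%g o.
have eN n : (c ^+ n)%g o = e n%:R.
  by rewrite /e val_Fp_nat // -oc expg_mod_order.
have /fin_all_exists[f fK] x : exists i, e i = x.
  have [k ->] := prime_perm_transitive p_pr cardX oc o x.
  by exists k%:R; rewrite eN.
have f_bij : bijective f.
  by apply: inj_card_bij (can_inj fK) _; rewrite cardX card_Fp.
have eK : cancel e f by apply/(bij_can_sym f_bij).
have cp : (c ^+ p)%g = 1%g by rewrite -oc expg_order.
have e_hom i j : s (e i) (e j) = e (linear_alexander a_unit i j).
  have i_lep : (i <= p)%N by rewrite ltnW // -[X in (_ < X)%N](Fp_cast p_pr).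
  (* A natural number representing j - i modulo [p]. *)
  pose n := (j + (p - i))%N.
  have Dj : e j = (c ^+ i)%g ((c ^+ n)%g o).
    by rewrite -permM -expgD -addnA subnK // expgD cp mulg1.
  rewrite -[s (e i) _]qpermE -qperm_conj ?groupX // Dj permJ.
  have -> : qperm s o ((c ^+ n)%g o) = (c ^+ (a * n))%g o.
    have so : qperm s o o = o by rewrite qpermE qop_idem.
    by rewrite expgM -Dca -conjXg -[X in _ = _ X]so permJ.
  rewrite -permM -expgD eN; congr e.
  rewrite /= /alexander_op natrD natrM natrD natrB // pchar_Fp_0 // !natr_Zp.
  by ring.
exists f => // x y /=; apply: (can_inj eK).
by rewrite -e_hom !fK.
Qed.

End TransitiveQuandle.

(** * Cyclic type and two-point homogeneity *)

Lemma ex_notin (T : finType) (A : {set T}) :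
  (#|A| < #|T|)%N -> exists x, x \notin A.
Proof.
rewrite -cardsT => ltA; have /properP[_ [x _ nAx]] : A \proper setT.
  by rewrite properEcard subsetT.
by exists x.
Qed.

Section CyclicType.
Variables (X : finType) (s : quandle X).

Lemma restr_qpermX x y k : y != x ->
  (restr_perm [set~ x] (qperm s x) ^+ k)%g y = (qperm s x ^+ k)%g y.
Proof.
have Ns : qperm s x \in ('N([set~ x] | 'P))%g.
  rewrite inE in_setT /= inE; apply/subsetP => z; rewrite !inE /= apermE.
  by apply: contraNneq => sz;
    rewrite -(inj_eq (@perm_inj _ (qperm s x))) sz qpermE qop_idem.
move=> yx; elim: k => [|k IHk]; first by rewrite !expg0.
rewrite !expgSr !permM IHk restr_permE // !inE.
have Dx : (qperm s x ^+ k)%g x = x by rewrite permX_fix // qpermE qop_idem.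
by rewrite -{2}Dx (inj_eq (@perm_inj _ _)).
Qed.

Lemma cyclic_typeP : cyclic_type s <->
  (3 <= #|X|)%N /\
  forall x y z, y != x -> z != x -> exists k, z = (qperm s x ^+ k)%g y.
Proof.
split=> -[X3 cyc]; split=> // x.
  move=> y z yx zx.
  have /imsetP[w _ Dw] := cyc x; set r := restr_perm _ _ in Dw.
  have yw : y \in porbit r w by rewrite -Dw !inE.
  have : z \in porbit r w by rewrite -Dw !inE.
  have -> : porbit r w = porbit r y by apply/esym/eqP; rewrite eq_porbit_mem.
  by case/porbitP => k ->; exists k; rewrite restr_qpermX.
have [y yx] : exists y, y != x.
  have [|y] := @ex_notin X [set x]; first by rewrite cards1 (leq_trans _ X3).
  by rewrite inE; exists y.
apply/imsetP; exists y => //; apply/setP => z; rewrite !inE.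
set r := restr_perm _ _; apply/idP/idP => [zx | /porbitP[k ->]].
  by have [k ->] := cyc x y z yx zx; rewrite -restr_qpermX // mem_porbit.
rewrite restr_qpermX //.
have Dx : (qperm s x ^+ k)%g x = x by rewrite permX_fix // qpermE qop_idem.
by rewrite -{2}Dx (inj_eq (@perm_inj _ _)).
Qed.

(** Powers of s_x move any point off [x] to any other. Choosing as centre a third point, which
    exists as |X| >= 3, gives transitivity; correcting the second point by a stabiliser element
    finishes. *)
Lemma cyclic_two_point : cyclic_type s -> two_point_homogeneous s.
Proof.
move=> /cyclic_typeP[X3 cyc].
have stab x y z : y != x -> z != x ->
    exists2 t, t \in Inn s & t x = x /\ t y = z.
  move=> yx zx; have [k ->] := cyc x y z yx zx.
  exists (qperm s x ^+ k)%g; first by rewrite groupX ?mem_Inn.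
  by rewrite permX_fix // qpermE qop_idem.
have trans x y : exists2 t, t \in Inn s & t x = y.
  have [w] : exists w, w \notin [set x; y].
    by apply: ex_notin; rewrite cards2; apply: leq_ltn_trans X3; case: (_ != _).
  rewrite !inE negb_or => /andP[wx wy].
  have [|| t Gt [_ <-]] := stab w x y; rewrite 1?eq_sym //.
  by exists t.
move=> x1 x2 y1 y2 x12 y12; have [t Gt tx1] := trans x1 y1.
have [||u Gu [uy1 <-]] := stab y1 (t x2) y2.
- by rewrite -tx1 (inj_eq (@perm_inj _ _)) eq_sym.
- by rewrite eq_sym.
by exists (t * u)%g; rewrite ?groupM // !permM tx1.
Qed.

Lemma two_point_transitive :
  (3 <= #|X|)%N -> two_point_homogeneous s -> Inn_transitive s.
Proof.
move=> X3 hom x y.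
have other (z : X) : exists w, z != w.
  have [|w] := @ex_notin X [set z]; first by rewrite cards1 (leq_trans _ X3).
  by rewrite inE eq_sym; exists w.
have [[x2 xx2] [y2 yy2]] := (other x, other y).
by have [t Gt [tx _]] := hom _ _ _ _ xx2 yy2; exists t.
Qed.

End CyclicType.

(** * Primitive roots and linear Alexander quandles *)

Section AlexanderIsomorphism.
Variables (X : finType) (s : quandle X) (p : nat).
Hypotheses (p_pr : prime p) (p_gt2 : (3 <= p)%N).
Variables (a : nat) (a_unit : (a%:R : 'F_p) \is a GRing.unit).
Variable f : X -> 'F_p.
Hypothesis f_hom : quandle_hom s (linear_alexander a_unit) f.
Hypothesis f_bij : bijective f.

Lemma qperm_alexander x y k :
  f ((qperm s x ^+ k)%g y) = a%:R ^+ k * (f y - f x) + f x.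
Proof.
elim: k => [|k IHk]; first by rewrite expg0 perm1 expr0 mul1r subrK.
rewrite expgSr permM qpermE; have /= -> := f_hom x _.
by rewrite IHk /alexander_op exprS; ring.
Qed.

Lemma Inn_alexander t : t \in Inn s ->
  exists k b, forall x, f (t x) = a%:R ^+ k * f x + b.
Proof.
move: t; apply: Inn_ind => [|t z [k [b IHt]]].
  by exists 0%N, 0 => x; rewrite perm1 expr0 mul1r addr0.
exists k.+1, (a%:R * b + (1 - a%:R) * f z) => x; rewrite permM qpermE.
by have /= -> := f_hom z _; rewrite IHt /alexander_op exprS; ring.
Qed.

Lemma primitive_cyclic : primitive_root p a -> cyclic_type s.
Proof.
move=> [_ [u Du /eqP genu]]; apply/cyclic_typeP.
rewrite (bij_eq_card f_bij) card_Fp //; split=> // x y z yx zx.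
have fD w : w != x -> f w - f x != 0.
  by rewrite subr_eq0 (inj_eq (bij_inj f_bij)).
(* The exponent sought is the discrete logarithm of this ratio to base [a], s_x being the homothety
   of ratio [a] centred at [x]. *)
have v_unit : (f z - f x) / (f y - f x) \is a GRing.unit.
  by rewrite unitfE mulf_neq0 ?invr_eq0 ?fD.
have /cycleP[k Dv] : FinRing.unit 'F_p v_unit \in <[u]>%g by rewrite -genu inE.
exists k; apply: (bij_inj f_bij); rewrite qperm_alexander.
have /(congr1 val) := Dv; rewrite FinRing.val_unitX /= Du => <-.
by rewrite divfK ?fD // subrK.
Qed.

(** An inner map sending (0, 1) to (0, z) is affine without constant term and with a power of [a] as
    slope, so z is that power. *)
Lemma two_point_primitive :
  (a < p)%N -> two_point_homogeneous s -> primitive_root p a.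
Proof.
move=> a_ltp hom; have [g fK gK] := f_bij.
have pow (z : 'F_p) : z != 0 -> exists k, z = a%:R ^+ k.
  move=> nz_z.
  have [||t Gt [t0 t1]] := hom (g 0) (g 1) (g 0) (g z).
  - by rewrite (inj_eq (can_inj gK)) eq_sym oner_eq0.
  - by rewrite (inj_eq (can_inj gK)) eq_sym.
  have [k [b Dt]] := Inn_alexander Gt; exists k.
  have := Dt (g 0); rewrite t0 !gK mulr0 add0r => Db.
  by have := Dt (g 1); rewrite t1 !gK mulr1 -Db addr0.
split; last first.
  exists (FinRing.unit 'F_p a_unit) => //.
  rewrite /generator eq_sym eqEsubset subsetT; apply/subsetP => v _.
  have [|k Dv] := pow (val v); first by rewrite -unitfE; apply: valP.
  by apply/cycleP; exists k; apply: val_inj; rewrite FinRing.val_unitX.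
have nz1 n : (0 < n < p)%N -> (n%:R : 'F_p) != 0.
  case/andP=> n0 np; rewrite -val_eqE /= val_Fp_nat //.
  by rewrite modn_small // -lt0n.
(* The value 0 is not a unit, and the powers of 1 miss 2, which is nonzero and different from 1 in
   ['F_p] as p >= 3. *)
case: a a_ltp a_unit pow => [|[|n]] ltp unit_n pow.
- by rewrite unitr0 in unit_n.
- have [|k] := pow 2%:R; first by rewrite nz1.
  rewrite expr1n => /eqP; rewrite -subr_eq0.
  by rewrite (_ : 2%:R - 1 = 1) ?oner_eq0 //; ring.
by rewrite /= subn1 -ltnS prednK ?prime_gt0.
Qed.

End AlexanderIsomorphism.

Theorem theorem4p11 (p : nat) (p_prime : prime p) (p_ge3 : (3 <= p)%N)
    (X : finType) (s : quandle X) (cardX : #|X| = p) :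
  (two_point_homogeneous s <->
     exists (a : nat) (a_unit : (a%:R : 'F_p) \is a GRing.unit),
       primitive_root p a /\ quandle_isomorphic s (linear_alexander a_unit)) /\
  ((exists (a : nat) (a_unit : (a%:R : 'F_p) \is a GRing.unit),
       primitive_root p a /\ quandle_isomorphic s (linear_alexander a_unit)) <->
     cyclic_type s).
Proof.
have imp12 : two_point_homogeneous s ->
    exists (a : nat) (a_unit : (a%:R : 'F_p) \is a GRing.unit),
      primitive_root p a /\ quandle_isomorphic s (linear_alexander a_unit).
  move=> hom; have X3 : (3 <= #|X|)%N by rewrite cardX.
  have [a [a_unit [ltap iso]]] :=
    transitive_affine p_prime cardX (two_point_transitive X3 hom).
  exists a, a_unit; split=> //; case: iso => f f_hom f_bij.
  exact: two_point_primitive f_hom f_bij ltap hom.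
have imp23 : (exists (a : nat) (a_unit : (a%:R : 'F_p) \is a GRing.unit),
      primitive_root p a /\ quandle_isomorphic s (linear_alexander a_unit)) ->
    cyclic_type s.
  case=> a [a_unit [prim [f f_hom f_bij]]].
  exact: primitive_cyclic f_hom f_bij prim.
have imp31 := @cyclic_two_point X s.
by split; split; auto.
Qed.
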